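(* Let $(X,|\cdot|_X)$ and $(Y,|\cdot|_Y)$ be real Banach spaces and let $f:X\to Y$ be a local $C^1$-diffeomorphism. Suppose that for some $y_0\in Y$, $$\inf\{\mathrm{sur}(f,x): x\in X,\ |f(x)-y_0|_Y<\varrho\}>0\quad\text{for all }\varrho>0.$$ Then there is a continuous nondecreasing function $h:[0,+\infty)\to[0,+\infty)$ with $\int_0^\infty\frac{1}{1+h(\rho)}\,d\rho=+\infty$ such that, for every $y\in Y$, the functional $F_y:X\to\mathbb{R}$, $F_y(x)=\frac12|f(x)-y|_Y^2$, satisfies the weighted Chang Palais-Smale condition for $h$.
   Context: A map $f:X\to Y$ is a local $C^1$-diffeomorphism if it is $C^1$ and $df(x)$ is a linear isomorphism of $X$ onto $Y$ for every $x\in X$. The surjection constant of $f$ at $x$ is $\mathrm{sur}(f,x)=\liminf_{r\to 0^+}\frac1r\sup\{R\ge 0: B_R(f(x))\subset f(B_r(x))\}$, where $B_r(\cdot)$ denotes a ball of radius $r$. For a locally Lipschitz functional $F:X\to\mathbb{R}$ on a real Banach space $X$ with dual $X^*$, the generalized directional derivative is $F^0(x;v)=\limsup_{z\to 0,\ t\downarrow 0}\frac1t\left(F(x+z+tv)-F(x+z)\right)$, the Clarke generalized gradient is $\partial F(x)=\{w^*\in X^*: \langle w^*,v\rangle\le F^0(x;v)\ \forall v\in X\}$ (a nonempty convex weak*-compact set), and $\lambda_F(x)=\min_{w^*\in\partial F(x)}|w^*|_{X^*}$. Given $h$, the functional $F$ satisfies the weighted Chang Palais-Smale condition for $h$ if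 any sequence $\{x_n\}$ in $X$ such that $\{F(x_n)\}$ is bounded and $\lim_{n\to\infty}\lambda_F(x_n)(1+h(|x_n|_X))=0$ contains a norm-convergent subsequence. *)

(* Defs.v *)
From HB Require Import structures.
From mathcomp Require Import all_boot all_order all_algebra.
From mathcomp Require Import all_classical all_reals all_analysis.

Set Implicit Arguments.
Unset Strict Implicit.
Unset Printing Implicit Defensive.

Import Order.TTheory GRing.Theory Num.Theory.
Import numFieldNormedType.Exports.

Local Open Scope classical_set_scope.
Local Open Scope ring_scope.

Section Operators.
Context {R : realType} {X Y : normedModType R}.

(* Extended-real valued; it is +oo on unbounded operators. *)
Definition op_norm (L : X -> Y) : \bar R :=
  ereal_sup [set `|L u|%:E | u in [set u : X | `|u| <= 1]].

(* The differential depends continuously on the point for the operator norm.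
   Bijectivity suffices for 'd f x to be a linear isomorphism of Banach spaces:
   differentiability includes its continuity, and its inverse is then bounded
   by the open mapping theorem. *)
Definition local_C1_diffeo (f : X -> Y) : Prop :=
  [/\ forall x, differentiable f x,
      forall x, op_norm ('d f z \- 'd f x) @[z --> x] --> 0%E
    & forall x, bijective ('d f x)].

(* Balls are open; the ball of radius 0 is empty, so rho = 0 is always
   admissible in the supremum.  The value may be +oo (when Y = 0). *)
Definition sur (f : X -> Y) (x : X) : \bar R :=
  limf_einf (fun r : R =>
    (r^-1%:E * ereal_sup [set rho%:E | rho in
       [set rho : R | (0 <= rho)%R /\ ball (f x) rho `<=` f @` ball x r]])%E)
    0^'+.

End Operators.

Section Clarke.
Context {R : realType} {X : normedModType R}.
Implicit Types (F : X -> R) (x v : X).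

Definition locally_lipschitz F : Prop :=
  forall x, exists2 U : set X, nbhs x U & [lipschitz F z | z in U].

(* In the limit superior, z = 0 is allowed whereas t > 0. *)
Definition gen_dderiv F x v : \bar R :=
  limf_esup (fun p : X * R =>
    ((F (x + p.1 + p.2 *: v) - F (x + p.1)) / p.2)%:E)
    (filter_prod (nbhs (0 : X)) (0 : R)^'+).

Definition clarke_grad F x : set {linear X -> R^o} :=
  [set w : {linear X -> R^o} |
    continuous w /\ forall v, ((w v : R)%:E <= gen_dderiv F x v)%E].

(* For a locally Lipschitz F this infimum is a minimum, since the gradient is
   nonempty and weak*-compact and the dual norm is weak* lower
   semicontinuous. *)
Definition clarke_lambda F x : \bar R :=
  ereal_inf [set op_norm (w : X -> R^o) | w in clarke_grad F x].

Definition weighted_chang_PS (h : R -> R) F : Prop :=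
  locally_lipschitz F /\
  forall u : nat -> X,
    bounded_fun (F \o u) ->
    (clarke_lambda F (u n) * (1 + h `|u n|)%:E)%E @[n --> \oo] --> 0%E ->
    exists2 phi : nat -> nat,
      {homo phi : m n / (m < n)%N} & cvg (u (phi n) @[n --> \oo]).

End Clarke.

(* Main.v *)
(** The choice h = 0 works.  A positive lower bound c on sur(f, .) makes f open
    at the linear rate c; with the C^1 property and the injectivity of df(x) the
    iteration of the open mapping theorem gives |df(x) u| >= (c/4) |u|, so f is
    locally expansive.  Hence segments of Y lift along f with uniformly Lipschitz
    lifts, as in the theorem of Hadamard and Plastock, and the endpoint of the lift
    of the segment from f(x) to y is a locally constant function of x in X, hence a
    constant z.  On the other hand, testing on v = df(x)^{-1}(y - f(x)) shows that
    every element of the Clarke gradient of F_y at x has norm at least a multiple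
    of |f(x) - y|, so a Palais-Smale sequence satisfies f(x_n) -> y, and the lifts
    give |x_n - z| <= C |f(x_n) - y|. *)
Require Import Defs.
From HB Require Import structures.
From mathcomp Require Import all_boot all_order all_algebra.
From mathcomp Require Import all_classical all_reals all_analysis.
From mathcomp Require Import ring lra.

Set Implicit Arguments.
Unset Strict Implicit.
Unset Printing Implicit Defensive.

Import Order.TTheory GRing.Theory Num.Theory.
Import numFieldNormedType.Exports.

Local Open Scope classical_set_scope.
Local Open Scope ring_scope.

(** * Lifting segments *)

(** Connectedness of [[0, b]] in continuation form: at the supremum of the [t] such that [P] holds
    on all of [[0, t]], [lim] gives [P], and [step] would go beyond that supremum if it were below
    [b]. *)
Lemma real_induction (R : realType) (P : R -> Prop) (b : R) :
  P 0 ->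
  (forall t, 0 <= t < b -> P t ->
     exists2 e, 0 < e & forall s, t <= s <= b -> s < t + e -> P s) ->
  (forall t, 0 < t <= b -> (forall s, 0 <= s < t -> P s) -> P t) ->
  forall t, 0 <= t <= b -> P t.
Proof.
move=> P0 step lim t0 /andP[t00 t0b].
have b0 : 0 <= b by exact: le_trans t0b.
pose A := [set t | 0 <= t <= b /\ forall s, 0 <= s <= t -> P s].
have A0 : A 0.
  split; first by rewrite lexx.
  by move=> s s0; have -> : s = 0 by lra.
have ubA : has_ubound A by exists b => t [/andP[]].
have supA : has_sup A by split => //; exists 0.
have c0 : 0 <= sup A by exact: (ub_le_sup ubA).
have cb : sup A <= b by apply: sup_le_ub => [|t [/andP[]]//]; exists 0.
have Plt s : 0 <= s < sup A -> P s.
  move=> /andP[s0 sc]; have [|e [eb Pe] ce] := @sup_adherent _ A (sup A - s) _ supA.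
    by rewrite subr_gt0.
  by apply: Pe; lra.
have Pc : P (sup A).
  have [<-//|cN0] := eqVneq 0 (sup A).
  by apply: lim => //; rewrite cb lt_neqAle cN0 c0.
have Ple s : 0 <= s <= sup A -> P s.
  move=> /andP[s0]; rewrite le_eqVlt => /predU1P[->//|sc].
  by apply: Plt; rewrite s0.
have [cltb|bc] := ltP (sup A) b; last by apply: Ple; lra.
have [e e0 Pe] := step (sup A) ltac:(lra) Pc.
pose m := Num.min b (sup A + e / 2).
have [mb me] : m <= b /\ m <= sup A + e / 2 by rewrite /m; split; rewrite ge_min lexx ?orbT.
have cm : sup A < m by rewrite /m lt_min cltb /=; lra.
have Am : A m.
  split; first by lra.
  move=> s /andP[s0 sm]; have [sc|cs] := leP s (sup A); first by apply: Ple; lra.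
  by apply: Pe; lra.
by have := ub_le_sup ubA Am; lra.
Qed.

(** For predicates whose truth value is locally constant: transfer from [t] to nearby points gives
    the step of real induction, transfer from an earlier point to [t] gives its limit case. *)
Lemma clopen_induction (R : realType) (P : R -> Prop) (b : R) :
  P 0 ->
  (forall t, 0 <= t <= b -> exists2 e, 0 < e & forall s s',
     0 <= s <= b -> 0 <= s' <= b -> `|s - t| < e -> `|s' - t| < e ->
     P s -> P s') ->
  forall t, 0 <= t <= b -> P t.
Proof.
move=> P0 loc; apply: real_induction => // t tb.
  move=> Pt; have [|e e0 Pe] := loc t; first by lra.
  exists e => // s sb se; apply: (Pe t) => //; rewrite ?subrr ?normr0//; try lra.
  by rewrite ltr_norml; lra.
move=> Plt; have [|e e0 Pe] := loc t; first by lra.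
pose m := Num.max 0 (t - e / 2).
have [m0 me] : 0 <= m /\ t - e / 2 <= m by rewrite /m; split; rewrite le_max lexx ?orbT.
have mt : m < t by rewrite /m gt_max; lra.
apply: (Pe m); rewrite ?subrr ?normr0//; try lra.
- by rewrite ltr_norml; lra.
- by apply: Plt; lra.
Qed.

Lemma lipschitz_left_limit (R : realType) (X : completeNormedModType R)
    (q : R -> X) (K t : R) : 0 <= K -> 0 < t ->
  (forall s s', 0 <= s < t -> 0 <= s' < t -> `|q s - q s'| <= K * `|s - s'|) ->
  exists l, forall s, 0 <= s < t -> `|l - q s| <= K * (t - s).
Proof.
move=> K0 t0 qlip.
have near_t (s : R) : s < t -> \forall r \near t^'-, s < r < t.
  by move=> st; near=> r; apply/andP; split; near: r;
    [exact: nbhs_left_gt | exact: nbhs_left_lt].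
have cq : cvg (q r @[r --> t^'-]).
  apply/cauchy_cvgP/cauchy_exP => e e0.
  (* Past this [s] the values of [q] vary by less than [e]; [K + 1] replaces [K] because [K] may be
     0. *)
  pose s := Num.max 0 (t - e / (2 * (K + 1))).
  have de0 : 0 < e / (2 * (K + 1)) by rewrite divr_gt0//; lra.
  have [s0 se] : 0 <= s /\ t - e / (2 * (K + 1)) <= s.
    by rewrite /s; split; rewrite le_max lexx ?orbT.
  have st : s < t by rewrite /s gt_max t0/=; lra.
  exists (q s).
  have : \forall r \near t^'-, `|q s - q r| < e.
    have := near_t _ st; apply: filterS => r srt.
    apply: (le_lt_trans (qlip _ _ _ _)); [by lra|by lra|].
    have -> : `|s - r| = r - s by rewrite distrC ger0_norm; lra.
    apply: (@le_lt_trans _ _ ((K + 1) * (e / (2 * (K + 1))))).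
      by apply: ler_pM; lra.
    have -> : (K + 1) * (e / (2 * (K + 1))) = e / 2 by field; lra.
    by lra.
  by apply: filterS => r; rewrite /= -ball_normE.
exists (lim (q r @[r --> t^'-])) => s s0t.
apply/ler_addgt0Pr => e e0.
have /cvgrPdist_lt/(_ _ e0) near_l := cq.
have [|r [lr srt]] := @filter_ex _ (t^'-) _ _ (filterI near_l (near_t s _)); first by lra.
rewrite -(subrKA (q r)) (le_trans (ler_normD _ _))//.
have := qlip r s ltac:(lra) ltac:(lra).
have -> : `|r - s| = r - s by rewrite ger0_norm; lra.
move=> qrs; have : K * (r - s) <= K * (t - s) by apply: ler_wpM2l => //; lra.
by move: lr qrs; rewrite /=; lra.
Unshelve. all: by end_near. Qed.

Section Lifting.
Context {R : realType} {X : completeNormedModType R} {Y : normedModType R}.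
Variables (f : X -> Y) (a : R) (D : set Y).

(** The rate [a] is common to all points whereas [d] may shrink from point to point; this is what
    gives all lifts a uniform speed. *)
Definition expansive_open (x : X) := exists2 d, 0 < d &
  (forall z z', `|z - x| < d -> `|z' - x| < d ->
     a * `|z - z'| <= `|f z - f z'|) /\
  (forall w, `|w - f x| < a * (d / 2) -> exists2 z, `|z - x| < d & f z = w).

(** A lift is a total function constrained on [[0, t]] only. The speed bound is part of the notion,
    so that limits and comparisons of lifts can use it directly. *)
Definition is_lift (y : Y) (x : X) (t : R) (p : R -> X) := [/\ p 0 = x,
  forall s, 0 <= s <= t -> f (p s) = f x + s *: (y - f x) &
  forall s s', 0 <= s <= t -> 0 <= s' <= t ->
    a * `|p s - p s'| <= `|y - f x| * `|s - s'|].

Hypothesis a0 : 0 < a.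
Hypothesis fc : continuous f.
Hypothesis fD : forall x, D (f x) -> expansive_open x.
Hypothesis Dconv : forall u v s, D u -> D v -> 0 <= s <= 1 -> D (u + s *: (v - u)).

Lemma is_lift_sub y x t s p : s <= t -> is_lift y x t p -> is_lift y x s p.
Proof.
move=> st [p0 pf pl]; split => //.
  by move=> r rs; apply: pf; lra.
by move=> r r' rs rs'; apply: pl; lra.
Qed.

(** If [p'] is close to [p] at a time [s] near [t], the speed bounds keep it inside the expansive
    ball of [p t] at every time [s'] near [t]. There the distance of the lifts is at most [1 / a]
    times that of their images, which is [(1 - s')] times the distance from [f x] to [f x'], hence
    small. *)
Lemma lift_stable y x T p : D y -> D (f x) -> T <= 1 -> is_lift y x T p ->
  forall t, 0 <= t <= T -> forall e, 0 < e -> exists2 d, 0 < d &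
    forall x' p', `|x' - x| < d -> is_lift y x' T p' -> `|p' t - p t| < e.
Proof.
move=> Dy Dx T1 [p0 pf pl]; apply: clopen_induction.
  by move=> e e0; exists e => // x' p' xx' [-> _ _]; rewrite p0.
move=> t tT.
have [d0 d00 [fexp _]] : expansive_open (p t).
  by apply: fD; rewrite pf//; apply: Dconv => //; lra.
set v := `|y - f x|; have v0 : 0 <= v by exact: normr_ge0.
(* Within time [r] a lift of speed [(v + 1) / a] moves by at most [d0 / 8]; [v + 1] bounds the
   distance from [y] to [f x'] once [f x'] is within 1 of [f x]. *)
pose r := a * d0 / (8 * (v + 1)).
have r0 : 0 < r by rewrite /r divr_gt0// ?mulr_gt0//; lra.
have rE : (v + 1) * r = a * (d0 / 8) by rewrite /r; field; lra.
exists r => // s s' sT s'T st s't Ps e e0.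
have [d1 d10 Pd1] := Ps (d0 / 4) ltac:(lra).
have m0 : 0 < Num.min 1 (a * e) by rewrite lt_min ltr01 mulr_gt0.
have /cvgrPdist_lt/(_ _ m0)/nbhs_ballP[d2 /= d20 Pd2] := @fc x.
exists (Num.min d1 d2); first by rewrite lt_min d10.
move=> x' p'; rewrite lt_min => /andP[xd1 xd2] lift'.
have psx' := Pd1 _ _ xd1 lift'.
have [p'0 p'f p'l] := lift'.
have fxx' : `|f x - f x'| < Num.min 1 (a * e).
  by apply: Pd2; rewrite -ball_normE /= distrC.
have [fx1 fxe] : `|f x - f x'| < 1 /\ `|f x - f x'| < a * e.
  by move: fxx'; rewrite lt_min => /andP.
have v' : `|y - f x'| <= v + 1.
  by rewrite -(subrKA (f x)) (le_trans (ler_normD _ _))// lerD// ltW.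
have near_p u : 0 <= u <= T -> `|u - t| < r -> `|p u - p t| <= d0 / 8.
  move=> uT ut; rewrite -(ler_pM2l a0) -rE.
  apply: (le_trans (pl _ _ _ _)) => //; apply: ler_pM => //; last exact: ltW.
  by rewrite -/v; lra.
have near_p' : `|p' s' - p' s| <= d0 / 4.
  rewrite -(ler_pM2l a0); have -> : a * (d0 / 4) = (v + 1) * (2 * r) by lra.
  apply: (le_trans (p'l _ _ _ _)) => //; apply: ler_pM => //.
  by rewrite -(subrKA t) (le_trans (ler_normD _ _))// (distrC t); lra.
have near_p's' : `|p' s' - p t| < d0.
  rewrite -(subrKA (p' s)) (le_lt_trans (ler_normD _ _))//.
  rewrite -[X in _ + `|X|](subrKA (p s)).
  have := ler_normD (p' s - p s) (p s - p t); have := near_p s sT st.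
  by lra.
rewrite -(ltr_pM2l a0).
apply: le_lt_trans (fexp _ _ near_p's' _) _.
  by have := near_p s' s'T s't; lra.
rewrite p'f// pf//; apply: le_lt_trans fxe.
have -> : f x' + s' *: (y - f x') - (f x + s' *: (y - f x)) =
          (1 - s') *: (f x' - f x).
  rewrite opprD addrACA -scalerBr scalerBl scale1r -scalerN.
  by congr (_ + s' *: _); rewrite [- (y - f x)]opprB addrC subrKA opprB.
rewrite normrZ (distrC (f x')) ger0_norm; last by lra.
by apply: ler_piMl => //; lra.
Qed.

(** Stability with equal origins. *)
Lemma lift_unique y x T p p' : D y -> D (f x) -> T <= 1 ->
  is_lift y x T p -> is_lift y x T p' ->
  forall t, 0 <= t <= T -> p t = p' t.
Proof.
move=> Dy Dx T1 lp lp' t tT; apply/eqP; rewrite eq_sym -subr_eq0 -normr_le0.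
apply/ler_addgt0Pr => e e0; rewrite add0r ltW//.
have [d d0 Pd] := lift_stable Dy Dx T1 lp tT e0.
by apply: (Pd x) => //; rewrite subrr normr0.
Qed.

(** The local inverse of [f] at [p t] lifts the next piece of the segment, and the two pieces are
    glued at [t]. *)
Lemma lift_extend y x t p : D y -> D (f x) -> 0 <= t < 1 -> is_lift y x t p ->
  exists2 e, 0 < e & forall s, t <= s <= 1 -> s < t + e ->
    exists p', is_lift y x s p'.
Proof.
move=> Dy Dx t01 lp; have [p0 pf pl] := lp.
have fpt : f (p t) = f x + t *: (y - f x) by apply: pf; lra.
have [d d0 [fexp fopen]] : expansive_open (p t).
  by apply: fD; rewrite fpt; apply: Dconv => //; lra.
set v := `|y - f x| in pl *; have v0 : 0 <= v by exact: normr_ge0.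
exists (a * (d / 2) / (v + 1)); first by rewrite divr_gt0// ?mulr_gt0//; lra.
move=> s s1 se.
have line r r' : f x + r *: (y - f x) - (f x + r' *: (y - f x)) =
    (r - r') *: (y - f x).
  by rewrite opprD addrACA subrr add0r -scalerBl.
(* The time constraint stands under the existential so that choice yields a total function. *)
have ex_q r : exists z, t <= r <= s -> `|z - p t| < d /\ f z = f x + r *: (y - f x).
  case: (boolP (t <= r <= s)) => [rts|_]; last by exists x.
  have [|z zd fz] := fopen (f x + r *: (y - f x)); last by exists z.
  rewrite fpt line normrZ -/v ger0_norm; last by lra.
  apply: (@le_lt_trans _ _ ((r - t) * (v + 1))); first by apply: ler_wpM2l; lra.
  by rewrite -ltr_pdivlMr; lra.
have [q qP] := choice ex_q.
have qt : q t = p t.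
  have [qtd fqt] := qP t ltac:(lra).
  apply/eqP; rewrite -subr_eq0 -normr_le0 -(pmulr_rle0 _ a0).
  apply: (le_trans (fexp _ _ qtd _)); first by rewrite subrr normr0.
  by rewrite fqt fpt subrr normr0.
have ql r r' : t <= r <= s -> t <= r' <= s -> a * `|q r - q r'| <= v * `|r - r'|.
  move=> rs r's; have [qr fqr] := qP _ rs; have [qr' fqr'] := qP _ r's.
  by apply: (le_trans (fexp _ _ qr qr')); rewrite fqr fqr' line normrZ mulrC.
pose p' r := if r <= t then p r else q r.
(* Across the junction both times and distances are split at [t], where [q] and [p] agree. *)
have mixed r r' : 0 <= r <= t -> t <= r' <= s -> a * `|p r - q r'| <= v * `|r - r'|.
  move=> rt r's.
  have -> : `|r - r'| = `|r - t| + `|t - r'|.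
    by rewrite !ler0_norm; lra.
  rewrite mulrDr; apply: (@le_trans _ _ (a * (`|p r - p t| + `|q t - q r'|))).
    by rewrite ler_pM2l// qt -[p r - _](subrKA (p t)) ler_normD.
  by rewrite mulrDr lerD// ?pl ?ql//; lra.
exists p'; split; rewrite /p'.
- by have -> : 0 <= t by lra.
- move=> r rs; case: (leP r t) => rt; first by apply: pf; lra.
  by apply: (qP _ _).2; lra.
- move=> r r' rs r's; case: (leP r t) => rt; case: (leP r' t) => r't; rewrite -/v.
  + by apply: pl; lra.
  + by apply: mixed; lra.
  + by rewrite distrC (distrC r); apply: mixed; lra.
  + by apply: ql; lra.
Qed.

(** By uniqueness the lifts over shorter intervals agree, so their diagonal [q] is a single lift on
    [[0, t)]. It is Lipschitz, and completeness of [X] supplies the missing endpoint. *)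
Lemma lift_limit y x t : D y -> D (f x) -> 0 < t <= 1 ->
  (forall s, 0 <= s < t -> exists p, is_lift y x s p) ->
  exists p, is_lift y x t p.
Proof.
move=> Dy Dx t01 ex_p.
have ex_P s : exists p, 0 <= s < t -> is_lift y x s p.
  case: (boolP (0 <= s < t)) => [/ex_p[p lp]|_]; first by exists p.
  by exists (fun=> x).
have [P liftP] := choice ex_P.
pose q s := P s s.
have qE s r : 0 <= s <= r -> r < t -> q s = P r s.
  move=> sr rt; apply: (@lift_unique y x s (P s) (P r)) => //; try lra.
  - by apply: liftP; lra.
  - by apply: (@is_lift_sub _ _ r); [lra | apply: liftP; lra].
set v := `|y - f x|; have v0 : 0 <= v by exact: normr_ge0.
have ql_le s s' : 0 <= s <= s' -> s' < t -> a * `|q s - q s'| <= v * `|s - s'|.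
  move=> ss' s't; rewrite (@qE s s')//.
  have [_ _ pl] := liftP s' ltac:(lra).
  by apply: pl; lra.
have ql s s' : 0 <= s < t -> 0 <= s' < t -> a * `|q s - q s'| <= v * `|s - s'|.
  move=> st s't; have [ss'|s's] := leP s s'; first by apply: ql_le; lra.
  by rewrite distrC (distrC s); apply: ql_le; lra.
have [||s s' st s't|l lP] := @lipschitz_left_limit R X q (v / a) t.
- by rewrite divr_ge0// ltW.
- by lra.
- by rewrite mulrAC ler_pdivlMr// mulrC ql.
have ll s : 0 <= s < t -> a * `|l - q s| <= v * `|t - s|.
  move=> st; have := lP _ st; rewrite mulrAC ler_pdivlMr// mulrC => /le_trans; apply.
  by rewrite ger0_norm//; lra.
have qf s : 0 <= s < t -> f (q s) = f x + s *: (y - f x).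
  by move=> st; have [_ pf _] := liftP s st; apply: pf; lra.
have fl : f l = f x + t *: (y - f x).
  apply/eqP; rewrite -subr_eq0 -normr_le0; apply/ler_addgt0Pr => e e0.
  have e20 : 0 < e / 2 by lra.
  have /cvgrPdist_lt/(_ _ e20)/nbhs_ballP[d /= d0 Pd] := @fc l.
  pose m := Num.min (d * a) (e / 2); have m0 : 0 < m by rewrite lt_min mulr_gt0.
  have [md me] : m <= d * a /\ m <= e / 2 by rewrite /m; split; rewrite ge_min lexx ?orbT.
  (* So close to [t], [q s] is within [d] of [l], and the segment moves by less than [e / 2] between
     times [s] and [t]. *)
  pose s := Num.max 0 (t - m / (v + 1)).
  have mv0 : 0 < m / (v + 1) by rewrite divr_gt0//; lra.
  have [s0 sm] : 0 <= s /\ t - m / (v + 1) <= s by rewrite /s; split; rewrite le_max lexx ?orbT.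
  have st : s < t by rewrite /s gt_max; lra.
  have vts : v * `|t - s| < m.
    rewrite ger0_norm; last by lra.
    apply: (@lt_le_trans _ _ ((v + 1) * (t - s))); first by rewrite ltr_pM2r; lra.
    by rewrite mulrC -ler_pdivlMr; lra.
  have : `|f l - f (q s)| < e / 2.
    apply: Pd; rewrite -ball_normE /=; rewrite -(ltr_pM2l a0).
    by apply: le_lt_trans (ll s _) _; lra.
  have : `|f (q s) - (f x + t *: (y - f x))| < e / 2.
    rewrite qf; last by lra.
    rewrite opprD addrACA subrr add0r -scalerBl normrZ mulrC (distrC s) -/v.
    by lra.
  rewrite -[f l - (f x + _)](subrKA (f (q s))).
  by have := ler_normD (f l - f (q s)) (f (q s) - (f x + t *: (y - f x))); lra.
pose p' r := if r < t then q r else l.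
exists p'; split; rewrite /p'.
- have -> : 0 < t by lra.
  by have [P00 _ _] := liftP 0 ltac:(lra); exact: P00.
- move=> s st; case: (ltP s t) => ts; first by apply: qf; lra.
  by have -> : s = t by lra.
- move=> s s' st s't; case: (ltP s t) => ts; case: (ltP s' t) => ts'; rewrite -/v.
  + by apply: ql; lra.
  + have -> : s' = t by lra.
    by rewrite distrC (distrC s); apply: ll; lra.
  + have -> : s = t by lra.
    by apply: ll; lra.
  + by rewrite subrr normr0 mulr0 mulr_ge0.
Qed.

Lemma lift_exists y x : D y -> D (f x) -> exists p, is_lift y x 1 p.
Proof.
move=> Dy Dx; apply: (@real_induction R (fun t => exists p, is_lift y x t p) 1).
- exists (fun=> x); split => //.
    by move=> s s0; have -> : s = 0 by [lra]; rewrite scale0r addr0.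
  by move=> s s' s0 s'0; rewrite subrr normr0 mulr0 mulr_ge0.
- by move=> t t1 [p]; exact: lift_extend.
- by move=> t t1; exact: lift_limit.
- by rewrite ler01 lexx.
Qed.

(* The endpoint of the lift is a locally constant function of its origin. *)
Lemma lift_endpoint_unique y x0 x1 p0 p1 : D y ->
  (forall s, 0 <= s <= 1 -> D (f (x0 + s *: (x1 - x0)))) ->
  is_lift y x0 1 p0 -> is_lift y x1 1 p1 -> p0 1 = p1 1.
Proof.
move=> Dy Dseg l0 l1.
pose c (s : R) := x0 + s *: (x1 - x0).
have [c0 c1] : c 0 = x0 /\ c 1 = x1.
  by rewrite /c scale0r addr0 scale1r addrC subrK.
suff : forall t, 0 <= t <= 1 -> forall p, is_lift y (c t) 1 p -> p0 1 = p 1.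
  by move=> /(_ 1); rewrite c1; apply => //; rewrite ler01 lexx.
have D0 : D (f (c 0)) by apply: Dseg; lra.
apply: clopen_induction.
  move=> p; rewrite c0 => lp; move: D0; rewrite c0 => D0.
  by apply: (lift_unique Dy D0 _ l0 lp); lra.
move=> t t1; have Dt := Dseg _ t1; have [p lp] := lift_exists Dy Dt.
have end_y z q : is_lift y z 1 q -> f (q 1) = y.
  by move=> [_ qf _]; rewrite qf ?ler01 ?lexx// scale1r addrC subrK.
have [e e0 [fexp _]] : expansive_open (p 1) by apply: fD; rewrite (end_y _ _ lp).
have [d d0 Pd] := lift_stable Dy Dt (lexx 1) lp (t := 1) ltac:(lra) e0.
(* All endpoints lie over [y], and [f] is injective near [p 1]; so an endpoint close to [p 1] equals
   it. *)
have near_end s q : `|s - t| < d / (`|x1 - x0| + 1) -> is_lift y (c s) 1 q -> q 1 = p 1.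
  move=> st lq; have x10 : 0 <= `|x1 - x0| by exact: normr_ge0.
  have cd : `|c s - c t| < d.
    rewrite /c opprD addrACA subrr add0r -scalerBl normrZ.
    apply: (@le_lt_trans _ _ (`|s - t| * (`|x1 - x0| + 1))).
      by apply: ler_wpM2l => //; lra.
    by rewrite -ltr_pdivlMr; lra.
  have qe := Pd _ _ cd lq.
  apply/eqP; rewrite -subr_eq0 -normr_le0 -(pmulr_rle0 _ a0).
  apply: (le_trans (fexp _ _ qe _)); first by rewrite subrr normr0.
  by rewrite (end_y _ _ lp) (end_y _ _ lq) subrr normr0.
exists (d / (`|x1 - x0| + 1)).
  by rewrite divr_gt0//; have := normr_ge0 (x1 - x0); lra.
move=> s s' s1 s'1 st s't Ps q lq.
(* The induction predicate speaks of all lifts from [c s], so one must exist before [Ps] says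
   anything. *)
have [p' lp'] := lift_exists Dy (Dseg _ s1).
by rewrite (Ps _ lp') (near_end _ _ st lp') (near_end _ _ s't lq).
Qed.

End Lifting.

(** * Surjection constant and local expansiveness *)

Section C1Diffeo.
Context {R : realType}.

Lemma op_norm_le_bound (X Y : normedModType R) (L : {linear X -> Y}) (c : R) (u : X) :
  (op_norm L <= c%:E)%E -> `|L u| <= c * `|u|.
Proof.
move=> Lc; have [->|u0] := eqVneq u 0; first by rewrite linear0 !normr0 mulr0.
have nu0 : 0 < `|u| by rewrite normr_gt0.
have : (`|L (`|u|^-1 *: u)|%:E <= c%:E)%E.
  apply: le_trans Lc; apply: ereal_sup_ubound; exists (`|u|^-1 *: u) => //=.
  by rewrite normrZ normfV normr_id mulVf// gt_eqF.
by rewrite lee_fin linearZ normrZ normfV normr_id ler_pdivrMl// mulrC.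
Qed.

(** For every small [r] the supremum of the admissible radii exceeds [c * r], hence so does one of
    these radii. *)
Lemma sur_gt_covering (X Y : normedModType R) (f : X -> Y) (x : X) (c : R) :
  (c%:E < sur f x)%E -> exists2 d, 0 < d & forall r, 0 < r < d ->
    forall w, `|w - f x| < c * r -> exists2 z, `|z - x| < r & f z = w.
Proof.
rewrite /sur limf_einfE => /ereal_sup_gt[_ [V [d /= d0 dV] <-] cV].
exists d => // r /andP[r0 rd] w wr.
have Vr : V r by apply: dV => //=; rewrite sub0r normrN gtr0_norm.
have : (c%:E < (r^-1)%:E * ereal_sup [set rho%:E | rho in
    [set rho : R | (0 <= rho)%R /\ ball (f x) rho `<=` f @` ball x r]])%E.
  by apply: lt_le_trans cV _; apply: ereal_inf_lbound; exists r.
rewrite lte_pdivlMl// -EFinM mulrC => /ereal_sup_gt[_ [rho [rho0 rhoS] <-]].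
rewrite lte_fin => crrho.
have [|z] := rhoS w; first by rewrite -ball_normE /= distrC (lt_trans wr).
by rewrite -ball_normE /= distrC => zr fz; exists z.
Qed.

Lemma differentiable_expansion (X Y : normedModType R) (f : X -> Y) (x : X) (e : R) :
  differentiable f x -> 0 < e -> exists2 d, 0 < d & forall h, `|h| < d ->
    `|f (x + h) - f x - 'd f x h| <= e * `|h|.
Proof.
move=> /diff_locally/eqaddoP fx /fx/nbhs_ballP[d /= d0 dP]; exists d => // h hd.
have := dP h; rewrite -ball_normE /= sub0r normrN => /(_ hd).
by rewrite !fctE /= opprD addrA (addrC h).
Qed.

(* The iteration scheme of the open mapping theorem. *)
Lemma approx_surj_bounded_below (X : completeNormedModType R) (Y : normedModType R)
    (L : {linear X -> Y}) (C : R) : continuous L -> injective L -> 0 <= C ->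
  (forall v, exists u, `|u| <= C * `|v| /\ `|v - L u| <= `|v| / 2) ->
  forall u, `|u| <= 2 * C * `|L u|.
Proof.
move=> Lc Linj C0 /choice[g gP] u0; set v0 := L u0.
(* [v n] is the residue after [n] corrections; it halves at each turn, so the corrections [u n] are
   dominated by a geometric series. *)
pose v n := iter n (fun v => v - L (g v)) v0.
pose u n := g (v n).
have vS n : v n.+1 = v n - L (u n) by [].
have vle n : `|v n| <= `|v0| * 2^-1 ^+ n.
  elim: n => [|n IH]; first by rewrite expr0 mulr1.
  rewrite vS (le_trans (gP (v n)).2)// exprSr mulrA.
  by rewrite ler_pM2r// invr_gt0.
have ule n : `|u n| <= geometric (C * `|v0|) 2^-1 n.
  by rewrite (le_trans (gP (v n)).1)//= -mulrA ler_wpM2l.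
have half1 : `|2^-1 : R| < 1 by rewrite ger0_norm ?invr_ge0// invf_lt1// ltr1n.
have ncvg : cvgn [normed series u].
  have geo0 n : 0 <= geometric (C * `|v0|) 2^-1 n.
    by apply: geometric_ge0; rewrite ?mulr_ge0 ?invr_ge0.
  apply: series_le_cvg geo0 ule _ => //; exact: is_cvg_geometric_series.
have ucvg := normed_cvg ncvg.
have Lseries n : L (series u n) = v0 - v n.
  elim: n => [|n IH]; first by rewrite /series /= big_geq// linear0 subrr.
  by rewrite seriesSr linearD IH vS opprB addrA addrAC.
have v_cvg0 : v n @[n --> \oo] --> 0.
  apply/cvgrPdist_le => e e0.
  have /cvgrPdist_le/(_ _ e0) := @cvg_geometric R `|v0| 2^-1 half1.
  apply: filterS => n; rewrite !sub0r !normrN => /(le_trans _); apply.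
  by rewrite (le_trans (vle n))//= ler_norm.
have Llim : L (limn (series u)) = v0.
  have Lcvg : L (series u n) @[n --> \oo] --> L (limn (series u)).
    by apply: continuous_cvg => //; exact: Lc.
  have v0cvg : L (series u n) @[n --> \oo] --> v0.
    under eq_fun do rewrite Lseries.
    have := cvgB (cvg_cst v0) v_cvg0; rewrite subr0; exact.
  exact: norm_cvg_unique Lcvg v0cvg.
(* Injectivity identifies [u0] with the sum of the corrections, so a bound on the chosen preimage
   becomes a bound on [u0]. *)
rewrite -(Linj _ _ Llim) (le_trans (lim_series_norm ncvg))//.
apply: limr_le => //; near=> n.
apply: (@le_trans _ _ (series (geometric (C * `|v0|) 2^-1) n)).
  by apply: ler_sum => i _; exact: ule.
apply: (le_trans (geometric_le_lim _ _ _ _)); rewrite ?mulr_ge0 ?invr_gt0//.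
by rewrite (_ : (1 - 2^-1)^-1 = 2 :> R); [lra | field].
Unshelve. all: by end_near. Qed.

(** Covering at scale [r] solves [f z = f x + t v] exactly. Linearizing shows that [t^-1 (z - x)]
    solves the equation for the differential up to half of [v], with constant [2 / c]; the iteration
    doubles it to [4 / c]. *)
Lemma sur_gt_diff_bounded_below (X : completeNormedModType R) (Y : normedModType R)
    (f : X -> Y) (x : X) (c : R) : differentiable f x -> injective ('d f x) ->
  0 < c -> (c%:E < sur f x)%E -> forall u, c / 4 * `|u| <= `|'d f x u|.
Proof.
move=> df dinj c0 /sur_gt_covering[d1 d10 cov] u.
suff : `|u| <= 2 * (2 / c) * `|'d f x u|.
  move=> /(ler_wpM2l (ltW c0)).
  have -> : c * (2 * (2 / c) * `|'d f x u|) = 4 * `|'d f x u| by field; lra.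
  by lra.
apply: approx_surj_bounded_below => //; [exact: diff_continuous|by rewrite divr_ge0// ltW|].
move=> v; have [->|vN0] := eqVneq v 0.
  by exists 0; rewrite linear0 subrr !normr0 mulr0 mul0r.
have v0 : 0 < `|v| by rewrite normr_gt0.
have [|d2 d20 dP] := differentiable_expansion (e := c / 4) df; first by lra.
pose r := Num.min d1 d2 / 2.
have m0 : 0 < Num.min d1 d2 by rewrite lt_min d10.
have [r1 r2] : r < d1 /\ r < d2.
  by rewrite /r; split; rewrite ltr_pdivrMr// gt_min ?ltr_pMr ?ltr1n ?orbT// ?orbT.
have r0 : 0 < r by rewrite /r divr_gt0.
(* This makes [t v] of norm [c r / 2], within reach of the covering, while the linearization error
   is at most [c r / 4], half of that norm. *)
pose t := c * r / (2 * `|v|).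
have t0 : 0 < t by rewrite /t divr_gt0 ?mulr_gt0.
have tv : t * `|v| = c * r / 2 by rewrite /t; field; lra.
have [||z zr fz] := cov r _ (f x + t *: v); first by rewrite r0.
  by rewrite addrC addKr normrZ gtr0_norm// tv; have := mulr_gt0 c0 r0; lra.
have := dP (z - x) ltac:(lra).
rewrite (addrC x) subrK fz (addrC (f x)) addrK => Lz.
exists (t^-1 *: (z - x)); split.
  rewrite normrZ normfV gtr0_norm// ler_pdivrMl//.
  have -> : t * (2 / c * `|v|) = r by rewrite mulrCA tv; field; lra.
  exact: ltW.
rewrite linearZ -(ler_pM2l t0) -{1}(gtr0_norm t0) -normrZ scalerBr scalerA.
rewrite divff ?gt_eqF// scale1r (le_trans Lz)//.
have : c / 4 * `|z - x| <= c / 4 * r by rewrite ler_wpM2l ?ltW//; lra.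
have -> : t * (`|v| / 2) = c * r / 4 by rewrite mulrA tv; lra.
by lra.
Qed.

Lemma mean_value_inequality (Y : normedModType R) (g : R -> Y) (K : R) :
  (forall t, 0 <= t <= 1 -> exists2 d, 0 < d & forall s, 0 <= s <= 1 ->
     `|s - t| < d -> `|g s - g t| <= K * `|s - t|) ->
  `|g 1 - g 0| <= K.
Proof.
move=> loc; suff : forall t, 0 <= t <= 1 -> `|g t - g 0| <= K * t.
  by move=> /(_ 1); rewrite mulr1; apply; rewrite ler01 lexx.
have glue s t : `|g s - g t| <= K * `|s - t| -> t <= s ->
    `|g t - g 0| <= K * t -> `|g s - g 0| <= K * s.
  move=> st ts t0; rewrite -(subrKA (g t)) (le_trans (ler_normD _ _))//.
  by move: st; rewrite ger0_norm; lra.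
apply: real_induction; first by rewrite subrr normr0 mulr0.
  move=> t t1 Pt; have [|d d0 dP] := loc t; first by lra.
  exists d => // s s1 sd; apply: (glue s t) => //; last by lra.
  by apply: dP; [lra | rewrite ger0_norm; lra].
move=> t t1 Plt; have [|d d0 dP] := loc t; first by lra.
pose s := Num.max 0 (t - d / 2).
have [s0 sd] : 0 <= s /\ t - d / 2 <= s by rewrite /s; split; rewrite le_max lexx ?orbT.
have st : s < t by rewrite /s gt_max; lra.
apply: (glue t s); [|exact: ltW|by apply: Plt; lra].
rewrite distrC (distrC t); apply: dP; first by lra.
by rewrite distrC ger0_norm; lra.
Qed.

Lemma near_lt_of_cvge0 (T : Type) (F : set_system T) {FF : Filter F}
    (g : T -> \bar R) (e : R) : 0 < e -> g t @[t --> F] --> 0%E ->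
  \forall t \near F, (g t < e%:E)%E.
Proof.
by move=> e0 g0; apply: (g0 [set y | (y < e%:E)%E]); apply: open_ereal_lt'; rewrite lte_fin.
Qed.

(** Strict differentiability, from the mean value inequality for [f] minus its linear part along the
    segment from [z] to [z']. Half of [e] pays for the variation of the differential, half for the
    remainder at the intermediate point. *)
Lemma C1_strict_expansion (X Y : normedModType R) (f : X -> Y) (x : X) (e : R) :
  local_C1_diffeo f -> 0 < e -> exists2 d, 0 < d & forall z z',
    `|z - x| < d -> `|z' - x| < d ->
    `|f z' - f z - 'd f x (z' - z)| <= e * `|z' - z|.
Proof.
move=> [df dfc _] e0; have e20 : 0 < e / 2 by lra.
have : \forall z \near x, (op_norm ('d f z \- 'd f x)%R < (e / 2)%:E)%E.
  exact: near_lt_of_cvge0 (dfc x).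
move=> /nbhs_ballP[d /= d0 dP]; exists d => // z z' zd z'd.
set u := z' - z.
pose g t := f (z + t *: u) - t *: 'd f x u.
have zu : z + u = z' by rewrite /u addrC subrK.
suff : `|g 1 - g 0| <= e * `|u|.
  by rewrite /g !scale1r !scale0r addr0 subr0 zu addrAC.
apply: mean_value_inequality => t t1.
set w := z + t *: u.
have wd : `|w - x| < d.
  have -> : w - x = (1 - t) *: (z - x) + t *: (z' - x).
    rewrite /w addrAC (_ : u = (z' - x) - (z - x)); last by rewrite opprB addrA subrK.
    by rewrite scalerBr scalerBl scale1r (addrC (t *: (z' - x))) addrA.
  rewrite (le_lt_trans (ler_normD _ _))// !normrZ !ger0_norm; [|lra..].
  (* One of the weights [t] and [1 - t] may vanish; strictness comes from the larger one. *)
  have [t12|t12] := ltP t (1 / 2).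
    have : (1 - t) * `|z - x| < (1 - t) * d by rewrite ltr_pM2l//; lra.
    have : t * `|z' - x| <= t * d by rewrite ler_wpM2l//; lra.
    by lra.
  have : (1 - t) * `|z - x| <= (1 - t) * d by rewrite ler_wpM2l//; lra.
  have : t * `|z' - x| < t * d by rewrite ltr_pM2l//; lra.
  by lra.
have opw : `|('d f w \- 'd f x) u| <= e / 2 * `|u|.
  apply: op_norm_le_bound; apply: ltW; apply: dP.
  by rewrite -ball_normE /= distrC.
have [d' d'0 d'P] := differentiable_expansion (df w) e20.
have u0 : 0 <= `|u| by [].
exists (d' / (`|u| + 1)); first by rewrite divr_gt0//; lra.
move=> s s1 st; set r := s - t in st *.
have rd' : `|r *: u| < d'.
  rewrite normrZ; apply: (@le_lt_trans _ _ (`|r| * (`|u| + 1))).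
    by apply: ler_wpM2l => //; lra.
  by rewrite -ltr_pdivlMr; lra.
have -> : g s - g t = (f (w + r *: u) - f w - 'd f w (r *: u)) +
    r *: ('d f w \- 'd f x) u.
  have -> : w + r *: u = z + s *: u by rewrite /w /r -addrA -scalerDl (addrC t) subrK.
  have -> : ('d f w \- 'd f x) u = 'd f w u - 'd f x u by [].
  rewrite linearZ (scalerBr r ('d f w u)) /= addrA subrK /g -/w opprD opprK addrACA /r scalerBl opprB.
  by congr (_ + _); rewrite addrC.
rewrite (le_trans (ler_normD _ _))//.
have := d'P _ rd'; rewrite !normrZ.
have : `|r| * `|('d f w \- 'd f x) u| <= `|r| * (e / 2 * `|u|) by rewrite ler_wpM2l.
by lra.
Qed.

(** The differential expands by [c / 4] and the strict error costs [c / 8], which leaves [c / 8].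
    Openness is the covering at radius [d / 2]. *)
Lemma sur_gt_expansive_open (X : completeNormedModType R) (Y : normedModType R)
    (f : X -> Y) (x : X) (c : R) : local_C1_diffeo f -> 0 < c ->
  (c%:E < sur f x)%E -> expansive_open f (c / 8) x.
Proof.
move=> hf c0 csur; have [df _ dbij] := hf.
have below := sur_gt_diff_bounded_below (df x) (bij_inj (dbij x)) c0 csur.
have [d1 d10 cov] := sur_gt_covering csur.
have [|d2 d20 strict] := C1_strict_expansion (e := c / 8) x hf; first by lra.
pose d := Num.min d1 d2; have d0 : 0 < d by rewrite lt_min d10.
have [dd1 dd2] : d <= d1 /\ d <= d2 by rewrite /d; split; rewrite ge_min lexx ?orbT.
exists d => //; split=> [z z' zd z'd|w wd].
  have := strict _ _ (lt_le_trans z'd dd2) (lt_le_trans zd dd2).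
  have := below (z - z').
  have := lerB_normD ('d f x (z - z')) (f z - f z' - 'd f x (z - z')).
  by rewrite (addrC ('d f x _)) subrK; lra.
have cd := mulr_gt0 c0 d0.
have [||z zd fz] := cov (d / 2) _ w; [by lra|by lra|].
by exists z => //; lra.
Qed.

End C1Diffeo.

(** * Clarke gradient of the half squared distance *)

Section HalfSquaredDistance.
Context {R : realType} {X Y : normedModType R}.
Variables (f : X -> Y) (y : Y).
Hypothesis hf : local_C1_diffeo f.
Let F (x : X) : R := 2^-1 * `|f x - y| ^+ 2.

Lemma half_sqr_dist_locally_lipschitz : locally_lipschitz F.
Proof.
move=> x; have [df _ _] := hf.
have [d d0 strict] := C1_strict_expansion x hf ltr01.
have [M M0 LM] : exists2 M, 0 <= M & forall u, `|'d f x u| <= M * `|u|.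
  have /linear_bounded_continuous/linear_boundedP := diff_continuous (df x).
  move=> /pinfty_ex_gt0[M M0 LM]; exists M => //; exact: ltW.
have lip z z' : `|z - x| < d -> `|z' - x| < d ->
    `|f z - f z'| <= (M + 1) * `|z - z'|.
  move=> zd z'd; have := strict _ _ z'd zd; have := LM (z - z').
  have := ler_normD (f z - f z' - 'd f x (z - z')) ('d f x (z - z')).
  by rewrite subrK; lra.
pose B := `|f x - y| + (M + 1) * d.
have near_y z : `|z - x| < d -> `|f z - y| <= B.
  move=> zd; rewrite -(subrKA (f x)) (le_trans (ler_normD _ _))// addrC lerD2l.
  rewrite (le_trans (lip _ _ zd _)) ?subrr ?normr0// ler_wpM2l ?ltW//; lra.
exists (ball x d); first exact: nbhsx_ballx.
have xx : (ball x d `*` ball x d) (x, x) by split; exact: ballxx.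
(* In the difference of squares the sum contributes [2 * B] and the difference [M + 1]; the factor
   one half cancels the 2. The point [xx] serves to make the filter proper. *)
apply: (@klipschitzW _ _ _ (B * (M + 1)) _ _ (globally_properfilter xx)) => -[z z'] /=.
rewrite -ball_normE /= !(distrC x) => -[zd z'd].
have zB := near_y _ zd; have z'B := near_y _ z'd; have zz' := lip _ _ zd z'd.
rewrite /F -mulrBr subr_sqr !normrM (@ger0_norm _ 2^-1) ?invr_ge0//.
rewrite (@ger0_norm _ (`|f z - y| + `|f z' - y|)) ?addr_ge0//.
have dist : `| `|f z - y| - `|f z' - y| | <= (M + 1) * `|z - z'|.
  apply: le_trans zz'; rewrite (le_trans (ler_dist_dist _ _))//.
  by rewrite opprB addrA subrK.
have := ler_pM (normr_ge0 _) (addr_ge0 (normr_ge0 _) (normr_ge0 _)) dist (lerD zB z'B).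
by rewrite /=; lra.
Qed.

(* Along [v] the map [f] moves straight towards [y], to first order. *)
Lemma gen_dderiv_half_sqr_dist (x v : X) : 'd f x v = y - f x -> f x != y ->
  (gen_dderiv F x v <= (- (`|f x - y| ^+ 2 / 8))%:E)%E.
Proof.
move=> dv fxy; have [df _ _] := hf.
set d := `|f x - y|.
have d0 : 0 < d by rewrite normr_gt0 subr_eq0.
have v0 : 0 <= `|v| by [].
(* With this precision the first-order error along [t *: v] is at most [t * (d / 4)]. *)
have ep0 : 0 < d / (4 * (`|v| + 1)) by rewrite divr_gt0//; lra.
have [r1 r10 strict] := C1_strict_expansion x hf ep0.
have d80 : 0 < d / 8 by lra.
have /cvgrPdist_lt/(_ _ d80)/nbhs_ballP[r2 /= r20 near_fx] :=
  differentiable_continuous (df x).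
pose A := [set z : X | `|z| < Num.min (r1 / 2) r2].
pose B := [set t : R | 0 < t < Num.min 1 (r1 / (2 * (`|v| + 1)))].
apply: ge_ereal_inf; exists (ereal_sup [set ((F (x + p.1 + p.2 *: v) -
    F (x + p.1)) / p.2)%:E | p in A `*` B]).
  exists (A `*` B) => //; exists (A, B); last exact: subset_refl.
  split => /=.
    apply/nbhs_ballP; exists (Num.min (r1 / 2) r2) => /=.
      by rewrite lt_min r20 divr_gt0.
    by move=> z; rewrite -ball_normE /= sub0r normrN.
  exists (Num.min 1 (r1 / (2 * (`|v| + 1)))) => /=.
    by rewrite lt_min ltr01 divr_gt0//; lra.
  by move=> t; rewrite /= sub0r normrN => tr t0; rewrite /B /= t0 (le_lt_trans (ler_norm t)).
apply: ge_ereal_sup => q [[z t] [zr tB] <-] {q}.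
move: zr tB; rewrite /A /B /= => zr /andP[t0 tr].
rewrite lee_fin.
move: zr tr; rewrite !lt_min => /andP[zr1 zr2] /andP[t1 tr1].
have tv : t * `|v| < r1 / 2.
  apply: (@le_lt_trans _ _ (t * (`|v| + 1))); first by rewrite ler_wpM2l ?ltW//; lra.
  move: tr1; rewrite ltr_pdivlMr; last by lra.
  by lra.
have xz : `|x + z - x| < r1 by rewrite addrC addKr; lra.
have xztv : `|x + z + t *: v - x| < r1.
  have -> : x + z + t *: v - x = z + t *: v by rewrite addrAC (addrC x) addrK.
  rewrite (le_lt_trans (ler_normD _ _))//.
  by rewrite normrZ gtr0_norm//; lra.
have fxz : `|f (x + z) - f x| < d / 8.
  by rewrite distrC; apply: near_fx; rewrite -ball_normE /= opprD addNKr normrN.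
have := strict _ _ xz xztv.
rewrite (addrC (x + z)) addrK linearZ /= dv normrZ (gtr0_norm t0).
set e := f _ - _ - _ => eP.
have {}eP : `|e| <= t * (d / 4).
  apply: (le_trans eP); rewrite mulrCA ler_pM2l//.
  rewrite mulrAC ler_pdivrMr; last by lra.
  by have := mulr_ge0 (ltW d0) v0; lra.
set a := `|f (t *: v + (x + z)) - y|; set b := `|f (x + z) - y|.
have aP : a <= (1 - t) * b + t * (d / 8) + t * (d / 4).
  have -> : a = `|(1 - t) *: (f (x + z) - y) + t *: (f (x + z) - f x) + e|.
    rewrite /a /e; congr (`|_|).
    have -> : t *: (f (x + z) - f x) = t *: (f (x + z) - y) + t *: (y - f x).
      by rewrite -scalerDr subrKA.
    rewrite scalerBl scale1r [_ - _ + (_ + _)]addrA subrK.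
    by rewrite addrACA subrr addr0 (addrC (f (x + z) - y)) subrKA.
  rewrite (le_trans (ler_normD _ _))// lerD//.
  rewrite (le_trans (ler_normD _ _))// !normrZ (gtr0_norm t0) ger0_norm; last by lra.
  by rewrite lerD2l ler_pM2l// ltW.
have bP : 7 / 8 * d <= b.
  have := ler_normD (f x - f (x + z)) (f (x + z) - y).
  by rewrite subrKA (distrC _ (f (x + z))) -/d -/b; lra.
have a0 : 0 <= a by exact: normr_ge0.
(* The decrease [t * b] is at least [7/8 t d], and the two errors take at most [3/8 t d] of it. *)
have ab : a <= b - t * (d / 2).
  have : t * (7 / 8 * d) <= t * b by rewrite ler_pM2l.
  by lra.
have ab2 : a ^+ 2 <= b ^+ 2 - t * (d / 2) * (7 / 8 * d).
  have : (t * (d / 2)) * (7 / 8 * d) <= (b - a) * (b + a).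
    by apply: ler_pM; rewrite ?mulr_ge0 //; lra.
  by lra.
(* Half of [7/16 t d^2] still exceeds [t d^2 / 8]. *)
rewrite ler_pdivrMr// /F -/a -/b.
have := mulr_gt0 t0 (mulr_gt0 d0 d0).
by lra.
Qed.

(** For [v] the preimage of [y - f x] under the differential, [w v] is at most [- d^2 / 8] while the
    norm of [v] is at most [d / c]. So [w] has norm at least [c d / 8], and 16 leaves room for a
    strict contradiction. *)
Lemma clarke_lambda_half_sqr_dist (x : X) (c : R) : 0 < c ->
  (forall u, c * `|u| <= `|'d f x u|) ->
  ((c / 16 * `|f x - y|)%:E <= clarke_lambda F x)%E.
Proof.
move=> c0 below; have [_ _ dbij] := hf.
apply: le_ereal_inf_tmp => _ [w [wc wF] <-].
have [fxy|fxy] := eqVneq (f x) y.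
  rewrite fxy subrr normr0 mulr0; apply: ereal_sup_ubound.
  by exists 0; rewrite /= ?normr0// linear0 normr0.
rewrite leNgt; apply/negP => wlt.
have [g fK gK] := dbij x.
set d := `|f x - y|; have d0 : 0 < d by rewrite normr_gt0 subr_eq0.
have := le_trans (wF _) (gen_dderiv_half_sqr_dist (gK (y - f x)) fxy).
set v := g _; rewrite lee_fin -/d => wv.
have cv : c * `|v| <= d by rewrite /d distrC -[y - f x]gK; exact: below.
have := op_norm_le_bound v (ltW wlt); rewrite -/d.
have : d / 16 * (c * `|v|) <= d / 16 * d by rewrite ler_wpM2l//; lra.
have := mulr_gt0 d0 d0.
have := ler_norm (- w v); rewrite normrN.
by lra.
Qed.

End HalfSquaredDistance.

(** * Global endpoint and the Palais-Smale condition *)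

Section GlobalInversion.
Context {R : realType} {X Y : completeNormedModType R}.
Variables (f : X -> Y) (y0 : Y).
Hypothesis hf : local_C1_diffeo f.
Hypothesis hsur : forall rho : R, 0 < rho ->
  (0 < ereal_inf [set sur f x | x in [set x : X | (`|f x - y0| < rho)%R]])%E.

Let D rho : set Y := [set w | `|w - y0| < rho].

Lemma sur_uniform_lower_bound rho : 0 < rho -> exists2 c, 0 < c &
  forall x, D rho (f x) -> (c%:E < sur f x)%E.
Proof.
move=> rho0; have := hsur rho0; set I := ereal_inf _ => I0.
have [c c0 cI] : exists2 c, 0 < c & (c%:E < I)%E.
  (* The infimum is [+oo] when, for instance, no [f x] lies in the ball. *)
  case: I I0 => [r|_|//]; last by exists 1 => //; exact: ltry.
  by rewrite lte_fin => r0; exists (r / 2); rewrite ?lte_fin; lra.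
exists c => // x Dx; apply: (lt_le_trans cI); apply: ereal_inf_lbound.
by exists x.
Qed.

Lemma convex_ball rho u v s : D rho u -> D rho v -> 0 <= s <= 1 ->
  D rho (u + s *: (v - u)).
Proof.
rewrite /D /= => Du Dv s01.
have -> : u + s *: (v - u) - y0 = (1 - s) *: (u - y0) + s *: (v - y0).
  have -> : v - u = (v - y0) - (u - y0) by rewrite opprB addrA subrK.
  by rewrite scalerBr scalerBl scale1r addrAC (addrC (s *: (v - y0))) addrA.
rewrite (le_lt_trans (ler_normD _ _))// !normrZ !ger0_norm; [|lra..].
have [s12|s12] := ltP s (1 / 2).
  have : (1 - s) * `|u - y0| < (1 - s) * rho by rewrite ltr_pM2l//; lra.
  have : s * `|v - y0| <= s * rho by rewrite ler_wpM2l//; lra.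
  by lra.
have : (1 - s) * `|u - y0| <= (1 - s) * rho by rewrite ler_wpM2l//; lra.
have : s * `|v - y0| < s * rho by rewrite ltr_pM2l//; lra.
by lra.
Qed.

(** The image of the segment from [x0] to [x1] is compact, so one ball around [y0] contains it
    together with [y], and a single bound on [sur] serves along the whole path. *)
Lemma lift_endpoint_const y x0 x1 a p0 p1 : 0 < a ->
  is_lift f a y x0 1 p0 -> is_lift f a y x1 1 p1 -> p0 1 = p1 1.
Proof.
move=> a0 l0 l1; have [df _ _] := hf.
have fc : continuous f by move=> x; exact: differentiable_continuous.
pose g (s : R) := f (x0 + s *: (x1 - x0)).
have gc : continuous g.
  move=> s; apply: (@continuous_comp _ _ _ (fun s : R => x0 + s *: (x1 - x0))).
    by apply: cvgD; [exact: cvg_cst | apply: cvgZr_tmp; exact: cvg_id].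
  exact: fc.
have [M [_ gM]] : bounded_set (g @` `[0, 1]).
  apply: compact_bounded; apply: continuous_compact; last exact: segment_compact.
  exact: continuous_subspaceT.
pose rho := `|M| + 1 + `|y - y0| + `|y0| + 1.
have rhoE : rho = `|M| + 1 + `|y - y0| + `|y0| + 1 by [].
have [M0 yy00 y00] : [/\ 0 <= `|M|, 0 <= `|y - y0| & 0 <= `|y0|] by split.
have rho0 : 0 < rho by lra.
have [c c0 csur] := sur_uniform_lower_bound rho0.
(* The larger ball may only allow a smaller rate; both lifts are weakened from [a] to the common
   rate [b / 8]. *)
pose b := Num.min c (8 * a).
have b0 : 0 < b by rewrite lt_min c0 mulr_gt0.
have [bc ba] : b <= c /\ b <= 8 * a by rewrite /b; split; rewrite ge_min lexx ?orbT.
have weaken x p : is_lift f a y x 1 p -> is_lift f (b / 8) y x 1 p.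
  move=> [px pf pl]; split => // s s' s1 s'1; apply: le_trans (pl _ _ s1 s'1).
  by apply: ler_wpM2r => //; lra.
apply: (@lift_endpoint_unique R X Y f (b / 8) (D rho) _ fc _ _ y x0 x1).
- by rewrite divr_gt0.
- move=> x Dx; apply: sur_gt_expansive_open => //.
  by apply: le_lt_trans (csur _ Dx); rewrite lee_fin.
- exact: convex_ball.
- by rewrite /D /=; lra.
- move=> s s1; rewrite /D /= -/(g s).
  have gs : `|g s| <= `|M| + 1.
    apply: gM; first by have := ler_norm M; lra.
    by exists s => //=; rewrite in_itv.
  by have := ler_normB (g s) y0; lra.
- exact: weaken.
- exact: weaken.
Qed.

Lemma half_sqr_dist_chang_PS y :
  weighted_chang_PS (fun=> 0) (fun x : X => 2^-1 * `|f x - y| ^+ 2).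
Proof.
split; first exact: half_sqr_dist_locally_lipschitz.
move=> u ubnd ucrit; have [df _ dbij] := hf.
have fc : continuous f by move=> x; exact: differentiable_continuous.
have [M uM] : exists M, forall n, `|f (u n) - y| <= M.
  have [M [_ uM]] := ubnd.
  have M1 : M < `|M| + 1 by have := ler_norm M; lra.
  (* A bound without square roots: [2 s <= s^2 + 1] for [s] the distance from [f (u n)] to [y]. *)
  exists (2 * (`|M| + 1) + 1) => n; have := uM _ M1 n I.
  rewrite /= ger0_norm ?mulr_ge0 ?invr_ge0 ?sqr_ge0// => sq.
  have := sqr_ge0 (`|f (u n) - y| - 1).
  by have := normr_ge0 M; lra.
pose rho := M + `|y - y0| + 1.
have M0 : 0 <= M by exact: le_trans (uM 0%N).
have yy0 : 0 <= `|y - y0| by [].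
have rho0 : 0 < rho by rewrite /rho; lra.
have Du n : D rho (f (u n)).
  rewrite /D /= /rho -(subrKA y) (le_lt_trans (ler_normD _ _))//.
  by have := uM n; lra.
have Dy : D rho y by rewrite /D /= /rho; lra.
have [c c0 csur] := sur_uniform_lower_bound rho0.
have [a0 c4] : 0 < c / 8 /\ 0 < c / 4 by lra.
have ex_p n : exists p, is_lift f (c / 8) y (u n) 1 p.
  apply: (@lift_exists R X Y f (c / 8) (D rho)) => //; last exact: convex_ball.
  by move=> x /csur; exact: sur_gt_expansive_open.
have [p lp] := choice ex_p.
(* The whole sequence converges, to the common endpoint of all the lifts. *)
exists id => //; apply/cvg_ex; exists (p 0%N 1).
apply/cvgrPdist_lt => e e0.
(* [c / 64] is the factor in the lower bound of [clarke_lambda] at rate [c / 4]; [c / 8] is the rate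
   of the lifts. *)
have e'0 : 0 < c / 64 * (c / 8 * e) by rewrite !mulr_gt0//; lra.
apply: filterS (near_lt_of_cvge0 e'0 ucrit) => n.
rewrite addr0 mule1 => lam.
have below := sur_gt_diff_bounded_below (df (u n)) (bij_inj (dbij (u n))) c0 (csur _ (Du n)).
have := le_lt_trans (clarke_lambda_half_sqr_dist y hf c4 below) lam.
rewrite lte_fin (_ : c / 4 / 16 = c / 64); last by field.
rewrite ltr_pM2l; last by lra.
move=> fun_y; rewrite -(ltr_pM2l a0); apply: le_lt_trans fun_y.
rewrite (lift_endpoint_const a0 (lp 0%N) (lp n)).
have [p0 _ pl] := lp n.
have := pl 1 0; rewrite subr0 normr1 mulr1 p0 (distrC y).
by apply; rewrite ?lexx ?ler01.
Qed.

End GlobalInversion.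

Unset Implicit Arguments.

Theorem mainTheorem6 (R : realType) (X Y : completeNormedModType R)
    (f : X -> Y) (y0 : Y) (hf : local_C1_diffeo f)
    (hsur : forall rho : R, 0 < rho ->
       (0 < ereal_inf
          [set sur f x | x in [set x : X | (`|f x - y0| < rho)%R]])%E) :
  exists h : R -> R,
    [/\ {within `[0, +oo[, continuous h},
        {in `[0, +oo[ &, {homo h : s t / s <= t}},
        (forall s, 0 <= s -> 0 <= h s),
        (\int[lebesgue_measure]_(s in `[0%R, +oo[) ((1 + h s)^-1)%:E = +oo)%E
      & forall y : Y,
          weighted_chang_PS h (fun x : X => 2^-1 * `|f x - y| ^+ 2)].
Proof.
exists (fun=> 0); split => //.
- by apply: continuous_subspaceT => x; exact: cvg_cst.
- rewrite addr0 invr1 integral_cst//= lebesgue_measure_itv /= ltry mul1e.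
  by rewrite oppr0 adde0.
- by move=> y; exact: half_sqr_dist_chang_PS hf hsur y.
Qed.
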